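(* For each positive integer $t$ and each positive integer $n$, there exists a complete morphism \[ \mathrm{BH}(n, 2^{t}) \rightarrow \mathrm{BH}(2^{2^{t-1}-1}n, 2). \] Equivalently, whenever there exists an $n\times n$ Butson Hadamard matrix with entries in the $2^t$-th roots of unity, there exists a real Hadamard matrix of order $2^{2^{t-1}-1}n$.
   Context: For positive integers $n,k$, $\mathrm{BH}(n,k)$ denotes the set of Butson Hadamard matrices: $n \times n$ complex matrices $H$ all of whose entries are $k$-th roots of unity and which satisfy $HH^{\ast} = nI_n$, where $H^{\ast}$ is the conjugate transpose. In particular $\mathrm{BH}(n,2)$ is the set of real ($\{\pm1\}$) Hadamard matrices of order $n$. A complete morphism is a function whose domain is all of $\mathrm{BH}(n,k)$ and whose codomain is $\mathrm{BH}(m,\ell)$. *)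

(* Defs.v *)
From mathcomp Require Import all_boot all_order all_algebra.
From mathcomp Require Import complex reals.

Set Implicit Arguments.
Unset Strict Implicit.
Unset Printing Implicit Defensive.

Import GRing.Theory Num.Theory.
Local Open Scope ring_scope.
Local Open Scope sesquilinear_scope.
Local Open Scope complex_scope.

Definition butson (R : realType) (n k : nat) (H : 'M[R[i]]_n) : Prop :=
  (forall i j, k.-unity_root (H i j)) /\ H *m H ^t* = n%:R%:M.

Definition BH (R : realType) (n k : nat) : Type :=
  {H : 'M[R[i]]_n | butson k H}.

Definition complete_morphism (R : realType) (n k m l : nat) : Type :=
  BH R n k -> BH R m l.

Definition real_hadamard (R : realType) (n : nat) (H : 'M[R]_n) : Prop :=
  (forall i j, H i j = 1 \/ H i j = -1) /\ H *m H^T = n%:R%:M.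

(* Main.v *)
Require Import Defs.
From mathcomp Require Import all_boot all_order all_algebra all_field.
From mathcomp Require Import complex reals mxtens.

(** Let r = 2 ^ (t - 1), and let z be a complex number with z ^+ r = -1, so that
    the (2 ^ t)-th roots of unity are the powers of z and a Butson matrix H has
    entries z ^+ e i j.  The identity H *m H^t* = n%:R%:M is then a family of
    relations, with rational coefficients, between powers of z.  Since 'X^r + 1
    is irreducible over the rationals ([irreducible_X2expD1]), each such relation
    is a multiple of 'X^r + 1 and therefore also holds for the powers of any
    matrix U with U ^+ r = -1 ([sum_exprmx_of_sum_expr]).

    So replace each entry z ^+ e i j by the real block U ^+ e i j *m M.  If U is
    orthogonal and M *m M^T is scalar, the rows of the resulting block matrix
    inherit the orthogonality of the rows of H ([real_hadamard_blocks]).  The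
    entries are +1 or -1 as soon as M has such entries and U is a signed
    permutation matrix.  It remains to find such a U and M of order
    m = 2 ^ (r - 1).  For M, take a Sylvester matrix.  For U, take a power of the
    negacyclic shift N of order m: as N ^+ m = -1 and r divides m, the matrix
    U = N ^+ (m %/ r) satisfies U ^+ r = -1.  The real matrix obtained in this
    way is a function of H, hence a complete morphism. *)

Section RealHadamardFromButson.

Set Implicit Arguments.
Unset Strict Implicit.
Unset Printing Implicit Defensive.

Import GRing.Theory Num.Theory.
Local Open Scope ring_scope.
Local Open Scope sesquilinear_scope.

(** * Rational relations between roots of unity of order a power of two *)

(** The order of z divides 2 ^ s.+1, hence is a power of two; a smaller power
    would divide 2 ^ s and force -1 = 1. *)
Lemma primitive_root_expN1 (F : numDomainType) s (z : F) :
  z ^+ (2 ^ s) = -1 -> (2 ^ s.+1).-primitive_root z.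
Proof.
move=> zs; have z1 : z ^+ (2 ^ s.+1) = 1 by rewrite expnSr exprM zs sqrrN expr1n.
have [m prim_m] := prim_order_exists (expn_gt0 2 s.+1) z1.
case/(dvdn_pfactor _ _ (isT : prime 2)) => j le_j Dm; rewrite Dm in prim_m *.
have [le_js|lt_sj] := leqP j s; last first.
  by have -> : s.+1 = j by apply/eqP; rewrite eqn_leq lt_sj.
have: (2 ^ j %| 2 ^ s)%N by rewrite dvdn_exp2l.
rewrite (prim_order_dvd prim_m) zs eq_sym -addr_eq0 -mulr2n.
by rewrite pnatr_eq0.
Qed.

(** The polynomial has a primitive root of unity z of order 2 ^ s.+1 as a root.
    The minimal polynomial of z is cyclotomic, of degree totient (2 ^ s.+1) =
    2 ^ s, so the two polynomials are associate. *)
Lemma irreducible_X2expD1 s : irreducible_poly ('X^(2 ^ s) + 1 : {poly rat}).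
Proof.
pose r := (2 ^ s)%N; have r_gt0 : (0 < r)%N by rewrite expn_gt0.
pose z : algC := r.-root (-1).
have zr : z ^+ r = -1 by rewrite rootCK.
have prim_z : (2 ^ s.+1).-primitive_root z := primitive_root_expN1 zr.
have szX : size ('X^r + 1 : {poly rat}) = r.+1 by rewrite size_XnaddC.
have nzX : 'X^r + 1 != 0 :> {poly rat} by rewrite -size_poly_eq0 szX.
have [p [Dp _] root_p] := minCpolyP z.
have szp : size p = r.+1.
  rewrite -(size_map_poly (ratr : {rmorphism rat -> algC})) -Dp.
  rewrite (minCpoly_cyclotomic prim_z) size_cyclotomic.
  by rewrite (totient_pfactor (isT : prime 2)) // mul1n.
have pX : p %= 'X^r + 1.
  rewrite -dvdp_size_eqp ?szp ?szX //.
  rewrite -root_p rmorphD rmorph1 /= map_polyXn rootE !hornerE zr.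
  by rewrite addNr.
(* z is a root of d or of e; whichever it is has full degree. *)
split=> [|d sz_d]; first by rewrite szX ltnS.
case/dvdpP=> e Xed; have [nze nzd] : e != 0 /\ d != 0.
  by apply/andP; rewrite -negb_or -mulf_eq0 -Xed.
have : root (map_poly ratr ('X^r + 1)) z.
  by rewrite root_p (eqp_dvdl _ pX).
rewrite Xed rmorphM rootM !root_p !(eqp_dvdl _ pX) => /orP[Xe|Xd]; last first.
  by rewrite /eqp -Xed Xd Xed dvdp_mull.
have /(dvdp_leq nze) := Xe; rewrite {1}Xed size_mul //.
by rewrite -[size d]prednK ?size_poly_gt0 // addnS /= -subn_eq0 addKn;
  move: sz_d nzd; rewrite -size_poly_gt0; case: (size d) => [|[]].
Qed.

(** A rational polynomial vanishing at z shares a root with 'X^(2 ^ s) + 1, so by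
    irreducibility it is a multiple of it, and the latter annihilates U. *)
Lemma horner_mx_eq0_of_root (F K : numFieldType) s m (z : F) (U : 'M[K]_m.+1)
    (q : {poly rat}) :
  z ^+ (2 ^ s) = -1 -> U ^+ (2 ^ s) = -1 ->
  root (map_poly ratr q) z -> horner_mx U (map_poly ratr q) = 0.
Proof.
move=> zs Us qz; set p : {poly rat} := 'X^(2 ^ s) + 1.
have pz : root (map_poly ratr p) z.
  by rewrite rmorphD rmorph1 /= map_polyXn rootE !hornerE zs addNr.
have /dvdpP[d ->] : p %| q.
  rewrite -[_ %| _]negbK -(irreducible_poly_coprime _ (irreducible_X2expD1 s)).
  apply/negP; rewrite -(coprimep_map (ratr : {rmorphism rat -> F})) => cpq.
  by have := coprimep_root cpq pz; rewrite -rootE qz.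
rewrite !rmorphM !rmorphD !rmorph1 /= map_polyXn rmorphXn /= horner_mx_X Us.
by rewrite addNr mulr0.
Qed.

Lemma sum_exprmx_of_sum_expr (F K : numFieldType) s m n (z : F) (U : 'M[K]_m.+1)
    (E : 'I_n -> nat) (c : nat) :
  z ^+ (2 ^ s) = -1 -> U ^+ (2 ^ s) = -1 ->
  \sum_j z ^+ E j = c%:R -> \sum_j U ^+ E j = c%:R.
Proof.
move=> zs Us sz; pose q : {poly rat} := \sum_j 'X^(E j) - c%:R.
have map_q (L : numFieldType) :
    map_poly ratr q = \sum_j 'X^(E j) - c%:R :> {poly L}.
  rewrite rmorphB rmorph_nat rmorph_sum /=; congr (_ - _).
  by apply: eq_bigr => j _; rewrite map_polyXn.
have qz : root (map_poly ratr q) z.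
  rewrite map_q rootE hornerD hornerN horner_sum -polyC_natr hornerC.
  by under eq_bigr do rewrite hornerXn; rewrite sz subrr.
have /eqP := horner_mx_eq0_of_root zs Us qz.
rewrite map_q rmorphB rmorph_nat rmorph_sum subr_eq0 => /eqP <-.
by apply: eq_bigr => j _; rewrite rmorphXn /= horner_mx_X.
Qed.

(** * Signed permutation matrices with a power equal to -1 *)

Definition pm1 (K : pzRingType) m n (M : 'M[K]_(m, n)) :=
  forall i j, M i j = 1 \/ M i j = -1.

(** The negacyclic shift: the companion matrix of 'X^m.+1 + 1. *)
Definition negashift (K : pzRingType) m : 'M[K]_m.+1 :=
  \matrix_(i, j) (if i == ord_max then - (j == ord0)%:R
                  else (j == inord i.+1)%:R).

Lemma mul_negashift (K : pzRingType) m p (M : 'M[K]_(m.+1, p)) i j :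
  (negashift K m *m M) i j =
  if i == ord_max then - M ord0 j else M (inord i.+1) j.
Proof.
rewrite mxE; case: ifP => im.
  rewrite (bigD1 ord0) //= big1 => [|k /negPf k0]; rewrite !mxE im.
    by rewrite eqxx mulN1r addr0.
  by rewrite k0 oppr0 mul0r.
rewrite (bigD1 (inord i.+1)) //= big1 => [|k /negPf k0]; rewrite !mxE im.
  by rewrite eqxx mul1r addr0.
by rewrite k0 mul0r.
Qed.

Lemma pm1_negashift (K : pzRingType) m k p (M : 'M[K]_(m.+1, p)) :
  pm1 M -> pm1 (negashift K m ^+ k *m M).
Proof.
move=> pmM; elim: k => [|k IHk] i j; first by rewrite expr0 mul1mx.
rewrite exprS -mulmxA mul_negashift; case: ifP => _ //.
by case: (IHk ord0 j) => ->; rewrite ?opprK; [right | left].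
Qed.

Lemma negashift_orthogonal (K : pzRingType) m :
  negashift K m *m (negashift K m)^T = 1%:M.
Proof.
apply/matrixP=> i k; rewrite mul_negashift !mxE.
have nmax (l : 'I_m.+1) : (l == ord_max) = false -> (l.+1 < m.+1)%N.
  move=> /negbT; rewrite -val_eqE /= => lm.
  by rewrite ltnS ltn_neqAle lm -ltnS ltn_ord.
have inord0 (l : 'I_m.+1) : (l == ord_max) = false ->
    (ord0 == inord l.+1 :> 'I_m.+1) = false.
  by move=> /nmax lm; rewrite -val_eqE /= inordK.
case: (altP (i =P ord_max)) => [->|/negPf im];
  case: (altP (k =P ord_max)) => [->|/negPf km].
- by rewrite !eqxx opprK.
- by rewrite inord0 // eq_sym km oppr0.
- by rewrite im eq_sym inord0 // oppr0.
by rewrite -val_eqE /= !inordK ?nmax // eqSS.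
Qed.

(** The k-th power moves row i + k to row i, rows being extended to all indices
    by M (i + m.+1) = - M i; the quotient counts the sign changes. *)
Lemma negashift_exp (K : pzRingType) m k p (M : 'M[K]_(m.+1, p)) i j :
  (negashift K m ^+ k *m M) i j =
  (-1) ^+ ((i + k) %/ m.+1) * M (inord ((i + k) %% m.+1)) j.
Proof.
elim: k i => [|k IHk] i.
  by rewrite expr0 mul1mx addn0 divn_small // modn_small // mul1r inord_val.
rewrite exprS -mulmxA mul_negashift; case: (altP (i =P ord_max)) => [->|im].
  rewrite IHk /= add0n -addSnnS divnDl // divnn /= modnDl.
  by rewrite exprS mulN1r mulNr.
rewrite IHk inordK ?addSnnS //.
by rewrite ltnS ltn_neqAle -ltnS ltn_ord andbT -[m]/(val (@ord_max m)) val_eqE.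
Qed.

Lemma negashift_expN1 (K : pzRingType) m : negashift K m ^+ m.+1 = -1.
Proof.
apply/matrixP=> i j; rewrite -[_ ^+ _]mulmx1 negashift_exp.
rewrite divnDr // divnn divn_small // modnDr modn_small //= inord_val mulN1r.
by rewrite !mxE.
Qed.

Lemma orthogonal_exp (K : comPzRingType) m (U : 'M[K]_m) k :
  U *m U^T = 1%:M -> U ^+ k *m (U ^+ k)^T = 1%:M.
Proof.
move=> UU; elim: k => [|k IHk]; first by rewrite expr0 trmx1 mulmx1.
by rewrite exprS trmx_mul mulmxA -(mulmxA U) IHk mulmx1.
Qed.

(** * Sylvester matrices and block matrices *)

(** The iterated Kronecker powers of the character table of the group of
    order 2. *)
Lemma sylvester (R : realType) k : {M : 'M[R]_(2 ^ k) | real_hadamard M}.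
Proof.
elim: k => [|k [M [pmM MM]]].
  exists 1%:M; split; last by rewrite trmx1 mulmx1.
  by move=> i j; left; rewrite (ord1 i) (ord1 j) mxE.
pose S : 'M[R]_2 := \matrix_(i, j) (-1) ^+ (i * j)%N.
have pmS : pm1 S.
  by move=> i j; rewrite mxE -signr_odd; case: odd; [right | left].
have SS : S *m S^T = 2%:R%:M.
  apply/matrixP=> i j; rewrite !mxE !big_ord_recl big_ord0 !mxE /= addr0.
  by case: i => [[|[|]]] //= ?; case: j => [[|[|]]] //= ?;
    rewrite ?expr0 ?expr1 ?mulN1r ?mulr1 ?mul1r ?opprK ?subrr ?mulr1n ?mulr0n.
rewrite expnS; exists (S *t M); split; last first.
  rewrite trmx_tens tensmx_mul SS MM.
  apply/matrixP=> i j; rewrite [LHS]mxE !mxE.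
  case: (mxtens_indexP i) => i1 i2; case: (mxtens_indexP j) => j1 j2.
  rewrite !mxtens_indexK /= (can_eq (@mxtens_indexK _ _)) xpair_eqE.
  by rewrite -!mulrnA -natrM mulnACA mulnb.
move=> i j; rewrite mxE.
by case: (pmS (mxtens_unindex i).1 (mxtens_unindex j).1) => ->;
  case: (pmM (mxtens_unindex i).2 (mxtens_unindex j).2) => ->;
  rewrite ?mulN1r ?mul1r ?opprK; [left|right|right|left].
Qed.

(** The indexing is that of the Kronecker product with the position inside a block
    as the first factor, so that the order is m * n rather than n * m. *)
Definition matrix_of_blocks (K : pzRingType) m n (B : 'I_n -> 'I_n -> 'M[K]_m) :
    'M[K]_(m * n) :=
  \matrix_(x, y) B (mxtens_unindex x).2 (mxtens_unindex y).2
                   (mxtens_unindex x).1 (mxtens_unindex y).1.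

Lemma matrix_of_blocksE (K : pzRingType) m n (B : 'I_n -> 'I_n -> 'M[K]_m) a i b j :
  matrix_of_blocks B (mxtens_index (a, i)) (mxtens_index (b, j)) = B i j a b.
Proof. by rewrite mxE !mxtens_indexK. Qed.

Lemma matrix_of_blocks_mul_tr (K : pzRingType) m n (B : 'I_n -> 'I_n -> 'M[K]_m)
    a i b k :
  (matrix_of_blocks B *m (matrix_of_blocks B)^T)
    (mxtens_index (a, i)) (mxtens_index (b, k)) =
  (\sum_j B i j *m (B k j)^T) a b.
Proof.
transitivity (\sum_c \sum_j B i j a c * B k j b c).
  rewrite pair_bigA mxE (reindex (@mxtens_index m n)); last first.
    by exists (@mxtens_unindex m n) => w _;
      rewrite (mxtens_indexK, mxtens_unindexK).
  apply: eq_bigr => -[c j] _.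
  by rewrite [(_^T) _ _]mxE !matrix_of_blocksE.
rewrite exchange_big summxE; apply: eq_bigr => j _.
by rewrite [RHS]mxE; apply: eq_bigr => c _; rewrite [(_^T) _ _]mxE.
Qed.

(** * From Butson to real Hadamard matrices *)

(** Conjugation sends z to z ^+ r', where r' = 2 ^ s.+1 - 1, because |z| = 1;
    transposition sends U to U ^+ r' because U is orthogonal.  Both sides of the
    orthogonality relations are thus sums of powers with the same exponents
    e i j + r' * e k j, and the relations carry over from z to U. *)
Lemma real_hadamard_blocks (R : realType) s m n (z : R[i]%C)
    (e : 'I_n -> 'I_n -> nat) (U M : 'M[R]_m.+1) :
    z ^+ (2 ^ s) = -1 ->
    (\matrix_(i, j) z ^+ e i j) *m (\matrix_(i, j) z ^+ e i j)^t* = n%:R%:M ->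
    U ^+ (2 ^ s) = -1 -> U *m U^T = 1%:M ->
    (forall k, pm1 (U ^+ k *m M)) -> M *m M^T = m.+1%:R%:M ->
  real_hadamard (matrix_of_blocks (fun i j => U ^+ e i j *m M)).
Proof.
move=> zs HH Us UU pmU MM; split=> [x y|]; first by rewrite mxE; apply: pmU.
pose r' := (2 ^ s.+1).-1.
have r'S : r'.+1 = (2 ^ s.+1)%N by rewrite prednK // expn_gt0.
have [z1 U1] : z ^+ (2 ^ s.+1) = 1 /\ U ^+ (2 ^ s.+1) = 1.
  by rewrite expnSr !exprM zs Us !sqrrN !expr1n.
have conj_z : z^*%C = z ^+ r'.
  have nz1 : `|z| = 1.
    apply/eqP; rewrite -(@pexpr_eq1 _ _ (2 ^ s.+1)) ?expn_gt0 //.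
    by rewrite -normrX z1 normr1.
  have zz : z * z^*%C = 1 by rewrite -[RHS](expr1n _ 2) -nz1 normCK.
  by rewrite -[LHS]mul1r -z1 -r'S exprSr -mulrA zz mulr1.
have tr_U : U^T = U ^+ r'.
  by rewrite -[LHS]mul1r -U1 -r'S exprSr -mulrA [U * _]UU mulr1.
have tr_Uk k : (U ^+ k)^T = U ^+ (r' * k).
  elim: k => [|k IHk]; first by rewrite muln0 !expr0 trmx1.
  by rewrite exprS trmx_mul IHk tr_U mulnS addnC exprD.
have block i k : \sum_j U ^+ (e i j + r' * e k j) = (n * (i == k))%:R.
  apply: (sum_exprmx_of_sum_expr zs Us).
  transitivity (((\matrix_(i, j) z ^+ e i j) *m
                 (\matrix_(i, j) z ^+ e i j)^t*) i k).
    rewrite mxE; apply: eq_bigr => j _.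
    by rewrite !mxE rmorphXn exprD exprM -conj_z.
  by rewrite HH !mxE natrM mulr_natr.
apply/matrixP=> x y.
case: (mxtens_indexP x) => a i; case: (mxtens_indexP y) => b k {x y}.
rewrite matrix_of_blocks_mul_tr.
under eq_bigr do rewrite trmx_mul mulmxA -(mulmxA _ M) MM mul_mx_scalar
   -scalemxAl tr_Uk [_ *m _](esym (exprD _ _ _)).
rewrite -scaler_sumr block scaler_nat -mulrnA mulmxnE !mxE.
rewrite (can_eq (@mxtens_indexK _ _)) xpair_eqE -mulnb -!mulrnA.
by congr (_%:R); rewrite [((n * _) * _)%N]mulnC [(m.+1 * (n * _))%N]mulnA mulnCA.
Qed.

Lemma real_hadamard_of_butson (R : realType) s n (H : 'M[R[i]%C]_n) :
  butson (2 ^ s.+1) H ->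
  {K : 'M[R]_(2 ^ (2 ^ s - 1) * n) | real_hadamard K}.
Proof.
case=> rootH HH; pose z : R[i]%C := (2 ^ s).-root (-1).
have zs : z ^+ (2 ^ s) = -1 by rewrite rootCK ?expn_gt0.
have prim_z := primitive_root_expN1 zs.
pose e i j : nat := sval (prim_rootP prim_z (unity_rootP (rootH i j))).
have He : H = \matrix_(i, j) z ^+ e i j.
  by apply/matrixP=> i j; rewrite mxE /e; case: prim_rootP.
have [M [pmM MM]] := sylvester R (2 ^ s - 1).
have Dm : (2 ^ (2 ^ s - 1)).-1.+1 = (2 ^ (2 ^ s - 1))%N.
  by rewrite prednK ?expn_gt0.
(* The order m of the shift is a multiple of 2 ^ s, since s <= 2 ^ s - 1. *)
have le_s : (s <= 2 ^ s - 1)%N.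
  by rewrite subn1 -ltnS prednK ?expn_gt0 // ltn_expl.
pose q := (2 ^ (2 ^ s - 1 - s))%N.
have Dq : (q * 2 ^ s)%N = (2 ^ (2 ^ s - 1))%N by rewrite /q -expnD subnK.
(* Powers of matrices under polynomial evaluation need a successor as order. *)
rewrite -{}Dm in M pmM MM Dq *; move: (_.-1) => m in M pmM MM Dq *.
exists (matrix_of_blocks (fun i j => (negashift R m ^+ q) ^+ e i j *m M)).
apply: (@real_hadamard_blocks _ s _ _ z) => //.
- by rewrite -He.
- by rewrite -exprM Dq negashift_expN1.
- exact/orthogonal_exp/negashift_orthogonal.
by move=> k; rewrite -exprM; apply: pm1_negashift.
Qed.

Lemma butson_of_real_hadamard (R : realType) n (K : 'M[R]_n) :
  real_hadamard K -> butson 2 (map_mx (real_complex R) K).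
Proof.
case=> pmK KK; split=> [i j|].
  rewrite unity_rootE mxE -rmorphXn /=.
  by case: (pmK i j) => ->; rewrite ?sqrrN expr1n rmorph1.
have -> : (map_mx (real_complex R) K)^t* = map_mx (real_complex R) K^T.
  apply/matrixP=> i j; rewrite !mxE.
  by case: (pmK j i) => ->; rewrite ?rmorphN !rmorph1.
by rewrite -map_mxM KK map_scalar_mx rmorph_nat.
Qed.

End RealHadamardFromButson.

(* The second conjunct is the "equivalently" form of the claim. *)
Theorem corollary1p5 (R : realType) (t n : nat) (ht : (0 < t)%N) (hn : (0 < n)%N) :
  inhabited (complete_morphism R n (2 ^ t) (2 ^ (2 ^ (t - 1) - 1) * n) 2) /\
  ((exists H : 'M[R[i]%C]_n, butson (2 ^ t) H) ->
   exists K : 'M[R]_(2 ^ (2 ^ (t - 1) - 1) * n), real_hadamard K).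
Proof.
case: t ht => // s _; rewrite (subn1 s.+1) /=.
split; last first.
  by case=> H bH; have [K hK] := real_hadamard_of_butson bH; exists K.
constructor=> -[H bH]; have [K hK] := real_hadamard_of_butson bH.
by exists (map_mx (real_complex R) K); apply: butson_of_real_hadamard.
Qed.
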